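(* Let $R$ be any totally ordered semi-ring. There is an absolute constant $\epsilon>0$ such that for all sufficiently large $n$, if the perfect matching polynomial $PM_{n}$ (on $2n$ vertices) is a monotone affine projection of the permanent $\mathrm{perm}_m$ over $R$, then $m\geq 2^{\epsilon n}$. In particular, the family $(PM_n)$ is not a monotone affine p-projection of the family $(\mathrm{perm}_m)$.
   Context: A (commutative) totally ordered semi-ring is a totally ordered set $(R,\leq)$ with operations $\times,+$ and elements $1\neq 0$ such that $(R,\times,1)$, $(R,+,0)$ are commutative monoids, $\times$ distributes over $+$, $0\times a=0$, $a+c\leq b+c$ whenever $a\leq b$, and $ac\leq bc$ whenever $a\leq b$ and $0\leq c$. An element $c$ is non-negative if $0\leq c$. Polynomials are formal polynomials over $R$. The permanent is $\mathrm{perm}_m(Y)=\sum_{\pi\in S_m} y_{1,\pi(1)}\cdots y_{m,\pi(m)}$ in the $m^2$ variables $y_{ij}$. The perfect matching polynomial (''unsigned Pfaffian'') in variables $x_{ij}$, $1\leq i<j\leq 2n$, is $PM_n=\sum_{\pi}\prod_{i=1}^n x_{\pi(2i-1),\pi(2i)}$, the sum over $\pi\in S_{2n}$ with $\pi(1)<\pi(3)<\dots<\pi(2n-1)$ and $\pi(2k-1)<\pi(2k)$ for all $k$, i.e. the sum over all perfect matchings of the complete graph on $2n$ vertices of the product of their edge variables. A polynomial $f(x_1,\dots,x_N)$ is a monotone affine projection of $g(y_1,\dots,y_M)$ if $f$ is obtained from $g$ by substituting for each $y_i$ an affine linear function $a_0+a_1x_1+\dots+a_Nx_N$ with all $a_k\in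 R$ non-negative. A family $(f_n)$ is a monotone affine p-projection of $(g_m)$ if there is a polynomially bounded $p$ with $f_n$ a monotone affine projection of $g_{p(n)}$ for all sufficiently large $n$. *)

(* Defs.v *)
From HB Require Import structures.
From mathcomp Require Import all_boot all_order all_algebra all_fingroup.

Set Implicit Arguments.
Unset Strict Implicit.
Unset Printing Implicit Defensive.

Import GRing.Theory.
Local Open Scope ring_scope.

(* Commutativity, distributivity, absorption and 1 != 0 are part of           *)
(* comNzSemiRingType; nothing is assumed on the sign of 1.                    *)
Record totally_ordered_semiring (R : comNzSemiRingType) (le : rel R) : Prop := {
  tosr_refl : reflexive le;
  tosr_anti : antisymmetric le;
  tosr_trans : transitive le;
  tosr_total : total le;
  tosr_add : forall a b c : R, le a b -> le (a + c) (b + c);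
  tosr_mul : forall a b c : R, le 0 c -> le a b -> le (a * c) (b * c)
}.

(* {mpoly R[n]} needs a ring of coefficients, which a totally ordered         *)
(* semi-ring need not be (e.g. Booleans, tropical numbers), so the            *)
(* polynomials in n variables are taken as R[x_(n-1)]...[x_0].                *)
Fixpoint mvpoly (R : comNzSemiRingType) (n : nat) : comNzSemiRingType :=
  if n is n'.+1 then {poly mvpoly R n'} else R.

Fixpoint mvpolyC (R : comNzSemiRingType) (n : nat) : R -> mvpoly R n :=
  match n return R -> mvpoly R n with
  | 0 => id
  | n'.+1 => fun c => (mvpolyC n' c)%:P
  end.

Fixpoint mvpolyX (R : comNzSemiRingType) (n : nat) : 'I_n -> mvpoly R n :=
  match n return 'I_n -> mvpoly R n with
  | 0 => fun=> 0
  | n'.+1 => fun i =>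
      if unlift ord0 i is Some j then (mvpolyX R j)%:P else 'X
  end.

(* Value at v of the polynomial whose coefficients are sent to S by h.        *)
Fixpoint mveval (R S : comNzSemiRingType) (h : R -> S) (n : nat) :
    ('I_n -> S) -> mvpoly R n -> S :=
  match n return ('I_n -> S) -> mvpoly R n -> S with
  | 0 => fun _ c => h c
  | n'.+1 => fun v p =>
      (map_poly (mveval h (fun i => v (lift ord0 i))) (p : {poly mvpoly R n'})).[v ord0]
  end.

Definition polyOn (R : comNzSemiRingType) (I : finType) : comNzSemiRingType :=
  mvpoly R #|I|.

Definition constOn (R : comNzSemiRingType) (I : finType) (c : R) : polyOn R I :=
  mvpolyC #|I| c.

Definition varOn (R : comNzSemiRingType) (I : finType) (i : I) : polyOn R I :=
  mvpolyX R (enum_rank i).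

Definition substOn (R : comNzSemiRingType) (I J : finType)
    (l : J -> polyOn R I) (g : polyOn R J) : polyOn R I :=
  mveval (@constOn R I) (fun k => l (enum_val k)) g.

Lemma mvpolyC_is_rmorphism (R : comNzSemiRingType) n :
  nmod_morphism (@mvpolyC R n) /\ monoid_morphism (@mvpolyC R n).
Proof.
elim: n => [|n [[C0 CD] [C1 CM]]]; first by [].
by split; split=> [|a b] /=; rewrite ?C0 ?C1 ?CD ?CM ?polyC0 ?polyC1 ?polyCD ?polyCM.
Qed.

Section EvalTheory.
Variables R S : comNzSemiRingType.

Lemma mveval_is_rmorphism (h : {rmorphism R -> S}) n (v : 'I_n -> S) :
  nmod_morphism (mveval h v) /\ monoid_morphism (mveval h v).
Proof.
elim: n v => [|n IHn] v /=.
  by split; split; [exact: rmorph0 | exact: rmorphD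
                   |exact: rmorph1 | exact: rmorphM].
set w := fun i => v (lift ord0 i); have [addw mulw] := IHn w.
pose fA := GRing.isNmodMorphism.Build _ _ (mveval h w) addw.
pose fM := GRing.isMonoidMorphism.Build _ _ (mveval h w) mulw.
pose f : {rmorphism mvpoly R n -> S} := HB.pack (mveval h w) fA fM.
rewrite -/w -[mveval h w]/(f : _ -> _).
split; split=> [|p q]; rewrite ?rmorph0 ?rmorph1 ?rmorphD ?rmorphM /=.
- by rewrite horner0.
- by rewrite hornerD.
- by rewrite hornerC.
- by rewrite hornerM.
Qed.

Lemma map_polyC_id0 (A B : comNzSemiRingType) (f : A -> B) (c : A) :
  f 0 = 0 -> map_poly f c%:P = (f c)%:P.
Proof.
by move=> f0; apply/polyP=> i; rewrite coef_map_id0 // !coefC; case: eqP.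
Qed.

Lemma mveval_const (h : R -> S) n (v : 'I_n -> S) (c : R) :
  h 0 = 0 -> mveval h v (mvpolyC n c) = h c.
Proof.
move=> h0; have ne0 k (w : 'I_k -> S) : mveval h w 0 = 0.
  by case: k w => //= k w; rewrite map_poly0 horner0.
by elim: n v => //= n IHn v; rewrite map_polyC_id0 // hornerC IHn.
Qed.

Lemma mveval_var (h : {rmorphism R -> S}) n (v : 'I_n -> S) (i : 'I_n) :
  mveval h v (mvpolyX R i) = v i.
Proof.
elim: n v i => [|n IHn] v i; first by case: i.
have [[ne0 _] [ne1 _]] := mveval_is_rmorphism h (fun i => v (lift ord0 i)).
rewrite /=; case: unliftP => [j|] ->; first by rewrite map_polyC_id0 ?hornerC ?IHn.
rewrite (_ : map_poly _ _ = 'X) ?hornerX //.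
by apply/polyP=> k; rewrite coef_map_id0 // !coefX; case: eqP.
Qed.

End EvalTheory.

Definition permanent (R : comNzSemiRingType) (m : nat) :
    polyOn R ('I_m * 'I_m)%type :=
  \sum_(s : 'S_m) \prod_(i < m) varOn R (i, s i).

Lemma substOn_permanent (R : comNzSemiRingType) (I : finType) (m : nat)
    (l : 'I_m * 'I_m -> polyOn R I) :
  substOn l (permanent R m) = \sum_(s : 'S_m) \prod_(i < m) l (i, s i).
Proof.
have [addC mulC] := mvpolyC_is_rmorphism R #|I|.
pose cA := GRing.isNmodMorphism.Build _ _ (@mvpolyC R #|I|) addC.
pose cM := GRing.isMonoidMorphism.Build _ _ (@mvpolyC R #|I|) mulC.
pose c : {rmorphism R -> polyOn R I} := HB.pack (@mvpolyC R #|I|) cA cM.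
rewrite /substOn; pose v (k : 'I_#|{: 'I_m * 'I_m}|) := l (enum_val k).
have [[e0 eD] [e1 eM]] := mveval_is_rmorphism c v.
rewrite -[@constOn R I]/(c : _ -> _) /permanent (big_morph _ eD e0).
apply: eq_bigr => s _; rewrite (big_morph _ eM e1); apply: eq_bigr => i _.
by rewrite mveval_var /v enum_rankK.
Qed.

(* Vertices are 0, ..., 2n - 1. *)
Definition edge (n : nat) : finType :=
  {e : 'I_(n.*2) * 'I_(n.*2) | (e.1 < e.2)%N}.

Lemma pos_left_subproof n (i : 'I_n) : (i.*2 < n.*2)%N.
Proof. by rewrite ltn_double. Qed.

Lemma pos_right_subproof n (i : 'I_n) : (i.*2.+1 < n.*2)%N.
Proof. by rewrite ltn_Sdouble. Qed.

Definition pos_left n (i : 'I_n) : 'I_(n.*2) := Ordinal (pos_left_subproof i).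
Definition pos_right n (i : 'I_n) : 'I_(n.*2) := Ordinal (pos_right_subproof i).

Definition edge_var (R : comNzSemiRingType) (n : nat) (i j : 'I_(n.*2)) :
    polyOn R (edge n) :=
  if insub (i, j) is Some e then varOn R (e : edge n) else 0.

Lemma edge_varE (R : comNzSemiRingType) n (i j : 'I_(n.*2)) (ij : (i < j)%N) :
  edge_var R i j = varOn R (Sub (i, j) ij : edge n).
Proof. by rewrite /edge_var insubT. Qed.

Definition matching_perm (n : nat) (s : 'S_(n.*2)) : bool :=
  [forall i : 'I_n, forall j : 'I_n,
     (i < j)%N ==> (s (pos_left i) < s (pos_left j))%N] &&
  [forall i : 'I_n, (s (pos_left i) < s (pos_right i))%N].

(* The default 0 of edge_var is never used: matching_perm gives i < j.        *)
Definition perfect_matching_poly (R : comNzSemiRingType) (n : nat) :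
    polyOn R (edge n) :=
  \sum_(s : 'S_(n.*2) | matching_perm s)
     \prod_(i < n) edge_var R (s (pos_left i)) (s (pos_right i)).

Definition monotone_affine_projection (R : comNzSemiRingType) (le : rel R)
    (I J : finType) (f : polyOn R I) (g : polyOn R J) : Prop :=
  exists (a0 : J -> R) (a : J -> I -> R),
    [/\ forall j, le 0 (a0 j),
        forall j i, le 0 (a j i)
      & f = substOn (fun j => constOn I (a0 j)
                              + \sum_(i : I) constOn I (a j i) * varOn R i) g].

Definition polynomially_bounded (p : nat -> nat) : Prop :=
  exists q : {poly nat}, forall n, (p n <= q.[n])%N.

Definition monotone_affine_p_projection (R : comNzSemiRingType) (le : rel R)
    (I J : nat -> finType) (f : forall n, polyOn R (I n))
    (g : forall m, polyOn R (J m)) : Prop :=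
  exists p : nat -> nat, polynomially_bounded p /\
    exists N : nat, forall n, (N <= n)%N ->
      monotone_affine_projection le (f n) (g (p n)).

(* Main.v *)
Require Import Defs.
From mathcomp Require Import all_boot all_order all_algebra.
From mathcomp Require Import reals exp.
From mathcomp Require Import all_fingroup boolp zify ring lra.

(* In a totally ordered semi-ring the non-nilpotent elements among the        *)
(* non-negative ones are closed under products, so only the supports of the   *)
(* affine entries matter: every permutation together with a choice of one     *)
(* term (a constant or an edge) in each of its entries yields a perfect       *)
(* matching of the 2n vertices V, and every perfect matching arises.          *)
(* Since all choices have the same total degree at each vertex, there are     *)
(* potentials r_i, c_j in Z^V such that the indicator vector of the label     *)
(* chosen in entry (i, j) is r_i + c_j. A matching M is thus a family of      *)
(* steps from points r_i to points - c_j, one for each edge of M, which       *)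
(* assemble into paths; when no path ends where another starts, the sets of   *)
(* starting and ending points do not depend on M and have at most n elements. *)
(* A path from p to q uses exactly the edges of M inside the support S of     *)
(* p - q. A random M splits a given S of size 2l with probability             *)
(* C(n, l) / C(2n, 2l), about 1 / 2n for l = 1 and O(1 / n^2) for             *)
(* 2 <= l <= n - 2. Hence the n^2 sets S coming from paths with at most       *)
(* k = n / 16 edges cover little more than half of the vertices on average,   *)
(* so a constant fraction of all M use a longer path. The first k edges of    *)
(* such a path form one of the m^2 sets supp(r_i + c_j), each split with      *)
(* probability at most 1 / C(n, k); this forces C(n, k) <= 4 m^2.             *)

Set Implicit Arguments.
Unset Strict Implicit.
Unset Printing Implicit Defensive.
Import Order.TTheory GRing.Theory Num.Theory.
Local Open Scope ring_scope.

Section OrderedSemiring.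
Variables (R : comNzSemiRingType) (le : rel R).
Hypothesis leP : totally_ordered_semiring le.

Definition nilpotent_elt (x : R) : Prop := exists k, x ^+ k = 0.

Lemma nilpotent_elt0 : nilpotent_elt 0.
Proof. by exists 1; rewrite expr1. Qed.

Lemma nilpotent_eltD x y :
  nilpotent_elt x -> nilpotent_elt y -> nilpotent_elt (x + y).
Proof.
move=> [j xj] [k yk]; exists (j + k)%N; rewrite exprDn big1 // => i _.
have [ki|ik] := leqP k i.
  by rewrite -(subnK ki) (exprD y) yk !mulr0 mul0rn.
have -> : (j + k - i = (k - i) + j)%N by lia.
by rewrite exprD xj mulr0 mul0r mul0rn.
Qed.

Lemma nilpotent_elt_sum (I : finType) (F : I -> R) :
  (forall i, nilpotent_elt (F i)) -> nilpotent_elt (\sum_i F i).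
Proof.
move=> nF; apply: big_ind => // [|x y]; first exact: nilpotent_elt0.
exact: nilpotent_eltD.
Qed.

Lemma nilpotent_eltM x y : nilpotent_elt x -> nilpotent_elt (x * y).
Proof. by move=> [k xk]; exists k; rewrite exprMn xk mul0r. Qed.

Lemma tosr_le0M x y : le 0 x -> le 0 y -> le 0 (x * y).
Proof. by move=> x0 y0; rewrite -(mul0r y); apply: (tosr_mul leP). Qed.

Lemma tosr_leDl x y : le 0 x -> le y (x + y).
Proof. by move=> x0; rewrite -{1}(add0r y); apply: (tosr_add leP). Qed.

Lemma tosr_le0D x y : le 0 x -> le 0 y -> le 0 (x + y).
Proof. by move=> x0 y0; apply: (tosr_trans leP) y0 (tosr_leDl _ x0). Qed.

Lemma tosr_le0_prod (I : finType) (F : I -> R) :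
  le 0 1 -> (forall i, le 0 (F i)) -> le 0 (\prod_i F i).
Proof. by move=> le01 F0; apply: (big_ind (le 0)) => // x y; apply: tosr_le0M. Qed.

Lemma tosr_sum_eq0 (I : finType) (F : I -> R) :
  (forall i, le 0 (F i)) -> \sum_i F i = 0 -> forall i, F i = 0.
Proof.
move=> F0 + i; rewrite (bigD1 i) //= addrC => S0.
apply: (tosr_anti leP); rewrite F0 andbT -S0 tosr_leDl //.
by apply: (big_ind (le 0)) => // [|x y]; [exact: (tosr_refl leP) | exact: tosr_le0D].
Qed.

Lemma not_nilpotent_elt1 : ~ nilpotent_elt 1.
Proof. by case=> k /eqP; rewrite expr1n oner_eq0. Qed.

Lemma tosr_natr_neq0 k : (k.+1)%:R != 0 :> R.
Proof.
apply/eqP => k0; have /eqP[] := oner_neq0 R; apply: (tosr_anti leP).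
have [le10|le01] := orP (tosr_total leP 1 0).
  suff le1 : le k.+1%:R 1 by rewrite le10 -k0.
  elim: k {k0} => [|k IHk]; first exact: (tosr_refl leP).
  apply: (tosr_trans leP) IHk; rewrite -[k.+2]add1n natrD -[X in le _ X]add0r.
  exact: (tosr_add leP).
rewrite le01 andbT -k0 -natr1 tosr_leDl //.
by elim: k {k0} => [|k IHk]; rewrite ?(tosr_refl leP) // -natr1 tosr_le0D.
Qed.

Lemma tosr_natr_not_nilpotent k : (0 < k)%N -> ~ nilpotent_elt k%:R.
Proof.
move=> k_gt0 [j /eqP]; rewrite -natrX.
by rewrite -(prednK (_ : 0 < k ^ j)%N) ?expn_gt0 ?k_gt0 // (negPf (tosr_natr_neq0 _)).
Qed.

(* Totality: if x <= y then x ^+ 2 <= x * y. *)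
Lemma not_nilpotent_eltM x y : le 0 x -> le 0 y ->
  ~ nilpotent_elt x -> ~ nilpotent_elt y -> ~ nilpotent_elt (x * y).
Proof.
wlog lexy : x y / le x y.
  move=> W x0 y0 nx ny; have [|] := orP (tosr_total leP x y); first by move/W; apply.
  by rewrite mulrC => /W; apply.
move=> x0 y0 nx _ [k xyk]; case: nx; exists (2 * k)%N; rewrite exprM expr2.
apply: (tosr_anti leP); rewrite -{1}xyk.
have le0X z j : le 0 z -> le 0 (z ^+ j.+1).
  by move=> z0; elim: j => // j IHj; rewrite exprS tosr_le0M.
have xx0 := tosr_le0M x0 x0; have xy0 := tosr_le0M x0 y0.
have lexx : le (x * x) (x * y) by rewrite [x * y]mulrC (tosr_mul leP).
case: k xyk => [|k] xyk; first by move/eqP: xyk; rewrite oner_eq0.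
rewrite le0X // andbT {xyk}; elim: k => [|k IHk]; first by rewrite !expr1.
rewrite exprS [X in le _ X]exprS; apply: (tosr_trans leP (y := x * x * (x * y) ^+ k.+1)).
  by rewrite mulrC [X in le _ X]mulrC (tosr_mul leP).
by apply: (tosr_mul leP); rewrite ?le0X.
Qed.

Lemma not_nilpotent_elt_prod (I : finType) (F : I -> R) : le 0 1 ->
    (forall i, le 0 (F i)) -> (forall i, ~ nilpotent_elt (F i)) ->
  ~ nilpotent_elt (\prod_i F i).
Proof.
move=> le01 F0 nF.
suff [] : le 0 (\prod_i F i) /\ ~ nilpotent_elt (\prod_i F i) by [].
apply: (big_ind (fun z => le 0 z /\ ~ nilpotent_elt z)) => [|x y [x0 nx] [y0 ny]|i _];
  split=> //.
- exact: not_nilpotent_elt1.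
- exact: tosr_le0M.
- exact: not_nilpotent_eltM.
Qed.

Lemma tosr_le01 x : le 0 x -> ~ nilpotent_elt x -> le 0 1.
Proof.
move=> x0 nx; have [//|le10] := orP (tosr_total leP 0 1).
have : le x 0 by rewrite -(mul1r x) -[X in le _ X](mul0r x) (tosr_mul leP).
move=> lex0; case: nx; suff -> : x = 0 by exact: nilpotent_elt0.
by apply: (tosr_anti leP); rewrite lex0.
Qed.

End OrderedSemiring.

Section ClosedWalks.
Variables (T : finType) (Z : zmodType) (g : rel T) (w : T -> T -> Z).

Fixpoint walk_sum (x : T) (p : seq T) : Z :=
  if p is y :: p' then w x y + walk_sum y p' else 0.

Lemma walk_sum_cat x p q :
  walk_sum x (p ++ q) = walk_sum x p + walk_sum (last x p) q.
Proof. by elim: p x => [|y p IHp] x /=; rewrite ?add0r // IHp addrA. Qed.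

Lemma walk_sum_next_at x y p : uniq (y :: p) ->
  \sum_(i <- y :: p) w i (next_at i x y p) = walk_sum y p + w (last y p) x.
Proof.
elim: p y => [|z p IHp] y; first by rewrite big_seq1 /= eqxx add0r.
rewrite cons_uniq => /andP[yp Up]; rewrite big_cons /= eqxx -addrA; congr (_ + _).
rewrite -IHp // !big_seq; apply: eq_bigr => i ip.
by move: ip yp => /=; case: eqP => // -> ->.
Qed.

Lemma not_uniq_split (s : seq T) : ~~ uniq s ->
  exists y s1 s2 s3, s = s1 ++ y :: s2 ++ y :: s3.
Proof.
elim: s => //= z s IHs; rewrite negb_and negbK => /orP[zs|/IHs].
  by case/splitPr: zs => s2 s3; exists z, [::], s2, s3.
by case=> y [s1 [s2 [s3 ->]]]; exists y, (z :: s1), s2, s3.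
Qed.

Hypothesis uniq_cycle_sum0 : forall c, uniq c -> path.cycle g c ->
  \sum_(i <- c) w i (next c i) = 0.

Lemma closed_walk_sum0 x p : path g x p -> last x p = x -> walk_sum x p = 0.
Proof.
elim: {p}(size p).+1 {-2}p (ltnSn (size p)) x => // n IHn p pn x gp lp.
have [Up|/not_uniq_split[y [p1 [p2 [p3 def_p]]]]] := boolP (uniq p).
  case: p pn gp lp Up => //= y p _ /andP[gxy gp] lp Up.
  have := uniq_cycle_sum0 (c := y :: p) Up; rewrite /= rcons_path gp lp gxy.
  by move/(_ isT); rewrite walk_sum_next_at // lp addrC.
move: pn gp lp; rewrite {}def_p !size_cat /= size_cat /= => pn.
rewrite cat_path /= cat_path /= last_cat /= last_cat /=.
case/and5P=> gp1 gy gp2 gy2 gp3 lp3.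
have p13 : walk_sum x (p1 ++ y :: p3) = 0.
  apply: IHn; rewrite ?size_cat /=; first by lia.
    by rewrite cat_path /= gp1 gy.
  by rewrite last_cat.
have p2y : walk_sum y (p2 ++ [:: y]) = 0.
  apply: IHn; rewrite ?size_cat /=; first by lia.
    by rewrite cat_path /= gp2 gy2.
  by rewrite last_cat.
move: p13 p2y; rewrite !walk_sum_cat /= !walk_sum_cat /= addr0 => p13 p2y.
by rewrite [walk_sum y p2 + _]addrA p2y add0r.
Qed.

(* Symmetry of [connect g] closes every walk from a root up to a cycle, so    *)
(* its sum only depends on its endpoint.                                      *)
Lemma exists_potential : connect_sym g ->
  exists phi : T -> Z, forall i j, g i j -> w i j = phi j - phi i.
Proof.
move=> gC.
have /choice[p pP] (j : T) :
    exists p, path g (fingraph.root g j) p /\ last (fingraph.root g j) p = j.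
  have /connectP[p gp lp] : connect g (fingraph.root g j) j by rewrite gC connect_root.
  by exists p; rewrite -lp.
exists (fun j => walk_sum (fingraph.root g j) (p j)) => i j gij.
have Dr : fingraph.root g i = fingraph.root g j by apply/(fingraph.rootP gC)/connect1.
have [[gpi li] [gpj lj]] := (pP i, pP j); rewrite -Dr in gpj lj *.
have /connectP[q gq lq] : connect g j (fingraph.root g i) by rewrite Dr connect_root.
have W1 : walk_sum (fingraph.root g i) (p j ++ q) = 0.
  by apply: closed_walk_sum0; rewrite ?cat_path ?last_cat lj ?gpj -?lq.
have W2 : walk_sum (fingraph.root g i) (p i ++ j :: q) = 0.
  by apply: closed_walk_sum0; rewrite ?cat_path ?last_cat /= ?li ?gpi ?gij -?lq.
move: W1 W2; rewrite !walk_sum_cat /= li lj => W1 W2.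
move/(canRL (addrK _)): W1 => ->; move/(canRL (addrK _)): W2 => ->.
by rewrite !sub0r opprK addrC addrK.
Qed.

End ClosedWalks.

Section PerfectMatchingPotential.
Variables (T : finType) (Lab : Type) (Z : zmodType).
Variables (L : T -> T -> Lab -> Prop) (chi : Lab -> Z) (z : Z).

Definition fits (s : {perm T}) (l : T -> Lab) := forall i, L i (s i) (l i).

Hypothesis fits_sum : forall s l, fits s l -> \sum_i chi (l i) = z.

Lemma fits_potential :
  exists r c : T -> Z, forall s l, fits s l -> forall i, chi (l i) = r i + c (s i).
Proof.
have [[s0 [l0 F0]]|nofit] := pselect (exists s l, fits s l); last first.
  by exists (fun=> 0), (fun=> 0) => s l F; case: nofit; exists s, l.
pose g i j := `[< exists s l, fits s l /\ s i = s0 j >].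
have /choice[lab labP] (ij : T * T) : exists y, g ij.1 ij.2 -> L ij.1 (s0 ij.2) y.
  case: (boolP (g ij.1 ij.2)) => [/asboolP[s [l [F <-]]]|_].
    by exists (l ij.1).
  by exists (l0 ij.1).
pose w i j := chi (lab (i, j)) - chi (l0 i).
have gC : connect_sym g.
  suff gc i j : connect g i j -> connect g j i by move=> i j; apply/idP/idP=> /gc.
  move=> /connectP[p gp ->] {j}; elim: p i gp => [|j p IHp] i /=.
    by rewrite connect0.
  case/andP=> /asboolP[s [l [F sij]]] /IHp{IHp}/connect_trans; apply.
  pose t := (s * s0^-1)%g.
  have <- : t i = j by rewrite permM sij permK.
  have tC := fconnect_sym (@perm_inj _ t).
  have : fconnect t (t i) i by rewrite tC fconnect1.
  apply: connect_sub => x _ /eqP <-; apply/connect1/asboolP.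
  by exists s, l; rewrite permM permKV.
have w0 c : uniq c -> path.cycle g c -> \sum_(i <- c) w i (next c i) = 0.
  move=> Uc gc; have nI : injective (next c) by apply: can_inj (prev_next Uc).
  pose s := (perm nI * s0)%g.
  pose l i := if i \in c then lab (i, next c i) else l0 i.
  have F : fits s l.
    move=> i; rewrite /s /l permM permE; case: ifP => ic.
      exact/(labP (i, _))/next_cycle.
    by rewrite next_nth ic.
  have /eqP := fits_sum F; rewrite -(fits_sum F0) -subr_eq0 -sumrB => /eqP S0.
  rewrite -[RHS]S0.
  rewrite big_uniq //= [RHS](bigID (mem c)) /=.
  rewrite [X in _ = _ + X]big1 => [|i /negPf ic]; last by rewrite /l ic subrr.
  by rewrite addr0; apply: eq_bigr => i ic; rewrite /l ic.
have [phi phiP] := exists_potential w0 gC.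
exists (fun i => chi (l0 i) - phi i), (fun j => phi (s0^-1 j)%g) => s l F i.
have gij : g i ((s0^-1)%g (s i)) by apply/asboolP; exists s, l; rewrite permKV.
rewrite -addrA [- _ + _]addrC -phiP // /w addrC subrK.
have Llab := labP (i, _) gij; rewrite /= permKV in Llab.
set y := lab _ in Llab *.
pose l' k := if k == i then y else l k.
have F' : fits s l' by move=> k; rewrite /l'; case: eqP => [->|].
have := fits_sum F; rewrite -(fits_sum F') (bigD1 i) //= [in RHS](bigD1 i) //=.
have -> : \sum_(k | k != i) chi (l' k) = \sum_(k | k != i) chi (l k).
  by apply: eq_bigr => k /negPf ki; rewrite /l' ki.
by rewrite /l' eqxx => /addIr.
Qed.

End PerfectMatchingPotential.

Section Matchings.
Variable n : nat.
Local Notation V := 'I_(n.*2).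

Lemma pos_index_subproof (u : V) : (u./2 < n)%N.
Proof. by rewrite ltn_half_double. Qed.

Definition pos_index (u : V) : 'I_n := Ordinal (pos_index_subproof u).

Definition pos_pair (i : 'I_n) : {set V} := [set pos_left i; pos_right i].

Lemma mem_pos_pair u i : (u \in pos_pair i) = (pos_index u == i).
Proof.
rewrite !inE -!val_eqE /=; apply/orP/eqP => [[]/eqP->|<-].
- by lia.
- by lia.
by have [uo|uo] := boolP (odd u); [right|left]; apply/eqP; lia.
Qed.

Definition matching (s : 'S_(n.*2)) : {set {set V}} := [set s @: pos_pair i | i : 'I_n].

Lemma mem_perm_pos_pair (s : 'S_(n.*2)) v i :
  (v \in s @: pos_pair i) = (pos_index ((s^-1)%g v) == i).
Proof. by rewrite -mem_pos_pair -{1}(permKV s v) mem_imset //; apply: perm_inj. Qed.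

Lemma perm_pos_pairE (s : 'S_(n.*2)) i :
  s @: pos_pair i = [set s (pos_left i); s (pos_right i)].
Proof. by rewrite /pos_pair imsetU1 imset_set1. Qed.

Lemma matching_permM (s t : 'S_(n.*2)) (q : 'I_n -> 'I_n) :
    (s * s)%g = 1%g -> (forall i, s @: pos_pair i = pos_pair (q i)) ->
  matching (s * t)%g = matching t.
Proof.
move=> ss sq.
have sub r : matching (s * r)%g \subset matching r.
  apply/subsetP => _ /imsetP[i _ ->]; apply/imsetP; exists (q i) => //.
  by rewrite -sq -imset_comp; apply: eq_imset => u; rewrite /= permM.
apply/eqP; rewrite eqEsubset sub /=.
by rewrite -[t in matching t \subset _]mul1g -ss -mulgA sub.
Qed.

Lemma swap_lt (d e a b : nat) :
  (a < b)%N -> (0 < e)%N -> ((d + e) * a + d * b < (d + e) * b + d * a)%N.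
Proof. by nia. Qed.

Lemma pos_left_inj : injective (@pos_left n).
Proof. by move=> i j [] /double_inj/val_inj. Qed.

Lemma pos_right_inj : injective (@pos_right n).
Proof. by move=> i j [] /double_inj/val_inj. Qed.

Lemma pos_left_neq_right i j : (pos_left i == pos_right j :> V) = false.
Proof. by apply/negP => /eqP[]; lia. Qed.

Lemma exists_matching_perm (s : 'S_(n.*2)) :
  exists2 t : 'S_(n.*2), matching_perm t & matching t = matching s.
Proof.
(* A permutation with the same pairs minimizing this weight is sorted.        *)
pose wt (t : 'S_(n.*2)) := (\sum_(i < n) (n - i) * t (pos_left i))%N.
case: (@arg_minnP _ s (fun t => matching t == matching s) wt (eqxx _)).
move=> t /eqP Et min_t; exists t => //; apply/andP; split.
  apply/forallP=> i; apply/forallP=> j; apply/implyP=> ij.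
  have nij : i != j by rewrite -val_eqE neq_ltn ij.
  rewrite ltnNge leq_eqVlt negb_or (inj_eq val_inj) (inj_eq perm_inj).
  rewrite (inj_eq pos_left_inj) eq_sym nij /=; apply/negP => tji.
  pose s1 := tperm (pos_left i) (pos_left j); pose s2 := tperm (pos_right i) (pos_right j).
  have s12L k : (s1 * s2)%g (pos_left k) = pos_left (tperm i j k).
    rewrite permM /s1 /s2 -(inj_tperm _ _ _ pos_left_inj) tpermD //.
      by rewrite eq_sym pos_left_neq_right.
    by rewrite eq_sym pos_left_neq_right.
  have s12R k : (s1 * s2)%g (pos_right k) = pos_right (tperm i j k).
    rewrite permM /s1 tpermD ?pos_left_neq_right // /s2.
    by rewrite -(inj_tperm _ _ _ pos_right_inj).
  have := min_t (s1 * s2 * t)%g; rewrite (@matching_permM _ _ (tperm i j)).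
  - rewrite Et eqxx => /(_ isT); apply/negP; rewrite -ltnNge /wt.
    rewrite (bigD1 i) // (bigD1 j) 1?eq_sym //= [X in (_ < X)%N](bigD1 i) //.
    rewrite [X in (_ < _ + X)%N](bigD1 j) 1?eq_sym //= !addnA.
    rewrite (eq_bigr (fun k : 'I_n => (n - k) * t (pos_left k))%N).
      rewrite ltn_add2r !(permM (s1 * s2)%g) !s12L tpermL tpermR.
      have -> : (n - i = (n - j) + (j - i))%N by have := ltn_ord j; lia.
      by apply: swap_lt; rewrite // subn_gt0.
    move=> k /andP[ki kj]; rewrite (permM (s1 * s2)%g) s12L tpermD // eq_sym //.
  - apply/permP => u; rewrite [LHS]permM perm1.
    by have := mem_pos_pair u (pos_index u); rewrite eqxx !inE => /orP[]/eqP->;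
      rewrite ?(s12L, s12R) tpermK.
  by move=> k; rewrite perm_pos_pairE s12L s12R.
apply/forallP => i.
rewrite ltnNge leq_eqVlt negb_or (inj_eq val_inj) (inj_eq perm_inj).
rewrite eq_sym pos_left_neq_right /=; apply/negP => tji.
have := min_t (tperm (pos_left i) (pos_right i) * t)%g; rewrite (@matching_permM _ _ id).
- rewrite Et eqxx => /(_ isT); apply/negP; rewrite -ltnNge /wt.
  rewrite (bigD1 i) //= [X in (_ < X)%N](bigD1 i) //=.
  rewrite (eq_bigr (fun k : 'I_n => (n - k) * t (pos_left k))%N).
    rewrite ltn_add2r permM tpermL.
    have := ltn_ord i; nia.
  move=> k ki; rewrite permM tpermD // ?(inj_eq pos_left_inj) 1?eq_sym //.
  by rewrite pos_left_neq_right.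
- exact: tperm2.
move=> k; rewrite perm_pos_pairE; have [->|ki] := eqVneq k i.
  by rewrite tpermL tpermR setUC.
rewrite !tpermD ?(inj_eq pos_left_inj) ?(inj_eq pos_right_inj) 1?eq_sym //.
all: by rewrite ?pos_left_neq_right // eq_sym pos_left_neq_right.
Qed.

End Matchings.

Section SplitCount.
Variable n : nat.
Local Notation V := 'I_(n.*2).

Definition splits (s : 'S_(n.*2)) (S : {set V}) : bool :=
  [forall i : 'I_n, (s (pos_left i) \in S) == (s (pos_right i) \in S)].

Lemma sum_pairs (F : V -> nat) :
  (\sum_u F u = \sum_(i < n) (F (pos_left i) + F (pos_right i)))%N.
Proof.
rewrite (partition_big (@pos_index n) xpredT) //; apply: eq_bigr => i _.
rewrite (eq_bigl (mem (pos_pair i))) => [|u]; last by rewrite /= mem_pos_pair.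
by rewrite big_setU1 ?big_set1 // inE pos_left_neq_right.
Qed.

Lemma card_split s S : splits s S -> #|S| = (#|[set i | s (pos_left i) \in S]|).*2.
Proof.
move=> /forallP sS; rewrite -sum1_card big_mkcond /=.
rewrite (reindex_inj (@perm_inj _ s)) sum_pairs -[RHS]addnn -sum1_card [in RHS]big_mkcond.
rewrite -big_split; apply: eq_bigr => i _.
by rewrite inE /= (eqP (sS i)).
Qed.

Lemma card_splits_le s l : (#|[set S | splits s S & #|S| == l.*2]| <= 'C(n, l))%N.
Proof.
rewrite -[X in 'C(X, _)](card_ord n) -card_draws.
pose f (S : {set V}) : {set 'I_n} := [set i | s (pos_left i) \in S].
rewrite -(@card_in_imset _ _ f); last first.
  move=> S S'; rewrite !inE => /andP[/forallP sS _] /andP[/forallP sS' _] /setP fE.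
  apply/setP => v; rewrite -(permKV s v); set u := (s^-1)%g v.
  have fu : (s (pos_left (pos_index u)) \in S) = (s (pos_left (pos_index u)) \in S').
    by have := fE (pos_index u); rewrite !inE.
  have := mem_pos_pair u (pos_index u); rewrite eqxx !inE => /orP[]/eqP-> //.
  by rewrite -(eqP (sS _)) -(eqP (sS' _)).
apply/subset_leq_card/subsetP => _ /imsetP[S + ->]; rewrite !inE => /andP[sS].
by rewrite (card_split sS) => /eqP/double_inj ->.
Qed.

Lemma exists_perm_imset (T : finType) (A B : {set T}) :
  #|A| = #|B| -> exists s : {perm T}, s @: A = B.
Proof.
elim: {A}_.+1 {-2}A (ltnSn #|A :\: B|) => // k IHk A ltk AB.
have [D0|[x]] := set_0Vmem (A :\: B).
  have AsB : A \subset B by rewrite -setD_eq0 D0.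
  exists 1%g; have /eqP -> : A == B by rewrite eqEcard AsB AB /=.
  by rewrite -[RHS]imset_id; apply: eq_imset => u; rewrite perm1.
move=> xAB; have : (0 < #|B :\: A|)%N.
  have E1 := cardsID B A; have E2 := cardsID A B; rewrite setIC in E2.
  have : (0 < #|A :\: B|)%N by apply/card_gt0P; exists x.
  lia.
case/card_gt0P=> y; move: xAB; rewrite !inE => /andP[xB xA] /andP[yA yB].
have xy : x != y by apply: contraNneq xB => ->.
have tA : tperm x y @: A = y |: (A :\ x).
  apply/setP=> z; rewrite -{1}(tpermK x y z) mem_imset ?inE; last exact: perm_inj.
  case: tpermP => [->|->|/eqP/negPf zx /eqP/negPf zy].
  - by rewrite (negPf xy) eqxx (negPf yA).
  - by rewrite eqxx xA.
  by rewrite zx zy.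
have [||s sB] := IHk (tperm x y @: A); last 1 first.
- by exists (tperm x y * s)%g; rewrite -sB -imset_comp; apply: eq_imset => z; rewrite /= permM.
- rewrite tA; apply: leq_trans (ltk : (#|A :\: B| <= k)%N).
  rewrite (cardsD1 x (A :\: B)) !inE xB xA add1n ltnS.
  apply/subset_leq_card/subsetP => z; rewrite !inE; case: eqP => [->|_] /=.
    by rewrite yB.
  by case/and3P => -> -> ->.
- by rewrite card_imset //; apply: perm_inj.
Qed.

Lemma card_splitting_perm l (S : {set V}) : #|S| = l.*2 ->
  (#|[set s | splits s S]| * 'C(n.*2, l.*2) <= (n.*2)`! * 'C(n, l))%N.
Proof.
move=> Sl; pose N (S' : {set V}) := #|[set s | splits s S']|.
have NE (S' : {set V}) : #|S'| = l.*2 -> N S' = N S.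
  move=> S'l; have [t <-] := @exists_perm_imset _ S S' (etrans Sl (esym S'l)).
  rewrite /N -!sum1_card [LHS]big_mkcond [RHS]big_mkcond /= (reindex_inj (mulIg t)) /=.
  apply: eq_bigr => s _; rewrite !inE; congr (if _ then _ else _).
  by apply: eq_forallb => i; rewrite !permM !mem_imset //; apply: perm_inj.
have -> : (#|[set s | splits s S]| * 'C(n.*2, l.*2) =
           \sum_(S' : {set V} | #|S'| == l.*2) N S')%N.
  rewrite (eq_bigr (fun=> N S)) => [|S' /eqP/NE //].
  rewrite sum_nat_const mulnC -[X in 'C(X, _)](card_ord n.*2) -card_draws.
  by congr (_ * _)%N; rewrite cardsE.
under eq_bigr do rewrite /N -sum1_card big_mkcond /=.
rewrite exchange_big /= -card_Sn.
apply: leq_trans (_ : \sum_(s : 'S_(n.*2)) 'C(n, l) <= _)%N; last first.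
  by rewrite sum_nat_const.
apply: leq_sum => s _; apply: leq_trans (card_splits_le s l).
rewrite -big_mkcondr /= sum1_card; apply/subset_leq_card/subsetP => S'.
by rewrite unfold_in => /andP[S'l]; rewrite !inE S'l andbT.
Qed.

End SplitCount.

Lemma bin_sqr_le n k : ('C(n, k) * 'C(n, k) <= 'C(n.*2, k.*2))%N.
Proof.
rewrite -!addnn -binomial.Vandermonde (bigD1 (inord k : 'I_(k + k).+1)) //=.
by rewrite inordK ?ltnS ?leq_addr // addnK leq_addr.
Qed.

Lemma leq_exp2_bin n k : (k.*2 <= n)%N -> (2 ^ k <= 'C(n, k))%N.
Proof.
move=> kn; apply: leq_trans (leq_bin2l k kn); elim: k {kn} => // k IHk.
rewrite doubleS binS (binS k.*2 k) expnS mul2n -addnn -addnA.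
apply: leq_trans (leq_addl _ _); rewrite leq_add //.
exact: leq_trans IHk (leq_bin2l _ _).
Qed.

Lemma leq_bin2r_half n k : (2 <= k)%N -> (k.*2 <= n)%N -> ('C(n, 2) <= 'C(n, k))%N.
Proof.
elim: k => // k IHk; rewrite ltnS leq_eqVlt => /orP[/eqP<- //|k2 kn].
apply: leq_trans (IHk k2 _) _; first by lia.
rewrite -(leq_pmul2l (ltn0Sn k)) mul_bin_left leq_mul2r; apply/orP; right; lia.
Qed.

Section ProjectionSupport.
Variables (R : comNzSemiRingType) (n m : nat).
Local Notation V := 'I_(n.*2).
Local Notation Lab := (option (edge n)).
Variables (a0 : 'I_m * 'I_m -> R) (a : 'I_m * 'I_m -> edge n -> R).

Definition entry_coef (ij : 'I_m * 'I_m) (o : Lab) : R :=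
  if o is Some e then a ij e else a0 ij.

Lemma sum_option (S : nmodType) (I : finType) (F : option I -> S) :
  \sum_o F o = F None + \sum_i F (Some i).
Proof.
rewrite (bigD1 None) //=; congr (_ + _).
rewrite (reindex_omap Some id) => [|[i|]] //=.
by apply: eq_bigl => i; rewrite eqxx.
Qed.

Hypothesis projE : perfect_matching_poly R n =
  substOn (fun j => constOn (edge n) (a0 j)
                    + \sum_(i : edge n) constOn (edge n) (a j i) * varOn R i)
          (permanent R m).

Lemma projection_eval (S : comNzSemiRingType) (h : {rmorphism R -> S}) (x : edge n -> S) :
  \sum_(s : 'S_(n.*2) | matching_perm s)
     \prod_(i < n) oapp x 0 (insub (s (pos_left i), s (pos_right i))) =
  \sum_(s : 'S_m) \sum_(l : {ffun 'I_m -> Lab})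
     \prod_i (h (entry_coef (i, s i) (l i)) * oapp x 1 (l i)).
Proof.
pose v (k : 'I_#|{: edge n}|) := x (enum_val k).
have [[e0 eD] [e1 eM]] := mveval_is_rmorphism h v.
have eC c : mveval h v (constOn (edge n) c) = h c by apply/mveval_const/rmorph0.
have eV e : mveval h v (varOn R e) = x e by rewrite mveval_var /v enum_rankK.
have := congr1 (mveval h v) projE; rewrite substOn_permanent.
rewrite /perfect_matching_poly !(big_morph _ eD e0).
rewrite (eq_bigr (fun s : 'S_(n.*2) =>
  \prod_(i < n) oapp x 0 (insub (s (pos_left i), s (pos_right i))))); last first.
  move=> s _; rewrite (big_morph _ eM e1); apply: eq_bigr => i _.
  by rewrite /edge_var; case: insub => [e|] /=.
move=> ->; apply: eq_bigr => s _; rewrite (big_morph _ eM e1).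
rewrite -(bigA_distr_bigA (fun i o => h (entry_coef (i, s i) o) * oapp x 1 o)).
apply: eq_bigr => i _; rewrite eD eC (big_morph _ eD e0) sum_option mulr1.
by congr (_ + _); apply: eq_bigr => e _; rewrite eM eC eV.
Qed.

Definition edge_set (e : edge n) : {set V} := [set (val e).1; (val e).2].

Definition covers (o : Lab) (v : V) : bool := oapp (fun e => v \in edge_set e) false o.

Variable le : rel R.
Hypothesis leP : totally_ordered_semiring le.
Hypotheses (a0_ge0 : forall j, le 0 (a0 j)) (a_ge0 : forall j e, le 0 (a j e)).
Hypothesis n_gt0 : (0 < n)%N.

Definition entry_label (i j : 'I_m) (o : Lab) : Prop :=
  ~ nilpotent_elt (entry_coef (i, j) o).

Lemma entry_coef_ge0 ij o : le 0 (entry_coef ij o).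
Proof. by case: o => [e|]; [apply: a_ge0 | apply: a0_ge0]. Qed.

Lemma edge_set_perm (s : 'S_(n.*2)) i (e : edge n) :
  insub (s (pos_left i), s (pos_right i)) = Some e -> edge_set e = s @: pos_pair i.
Proof. by rewrite perm_pos_pairE; case: insubP => //= u _ + [<-]; rewrite /edge_set /= => ->. Qed.

Lemma insub_matching_perm (s : 'S_(n.*2)) i : matching_perm s ->
  exists2 e : edge n, insub (s (pos_left i), s (pos_right i)) = Some e
                    & edge_set e = s @: pos_pair i.
Proof.
move=> /andP[_ /forallP/(_ i) si]; have := @edge_set_perm s i.
by case: insubP => [e _ _ /(_ e erefl)|]; [exists e | rewrite si].
Qed.

Lemma matching_label (s : 'S_(n.*2)) : exists (t : 'S_m) (l : 'I_m -> Lab),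
  fits entry_label t l /\ forall i e, l i = Some e -> edge_set e \in matching s.
Proof.
have [t tP Et] := exists_matching_perm s.
have := projection_eval idfun (fun e => (edge_set e \in matching s)%:R).
have -> : \sum_(t0 : 'S_(n.*2) | matching_perm t0)
    \prod_(i < n) oapp (fun e => (edge_set e \in matching s)%:R) 0
       (insub (t0 (pos_left i), t0 (pos_right i))) =
    (\sum_(t0 : 'S_(n.*2) | matching_perm t0)
        \prod_(i < n) (t0 @: pos_pair i \in matching s))%:R :> R.
  rewrite natr_sum; apply: eq_bigr => u uP; rewrite natr_prod; apply: eq_bigr => i _.
  by have [e -> /= ->] := insub_matching_perm i uP.
set k := (\sum_(_ | _) _)%N => kE.
have k_gt0 : (0 < k)%N.
  rewrite /k (bigD1 t) //= big1 // => i _.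
  by rewrite -Et imset_f.
apply: contrapT => noL; apply: (tosr_natr_not_nilpotent leP k_gt0); rewrite kE.
apply: nilpotent_elt_sum => u; apply: nilpotent_elt_sum => l.
apply: contrapT => nl; apply: noL; exists u, l.
have nlF i : ~ nilpotent_elt (entry_coef (i, u i) (l i) *
    oapp (fun e => (edge_set e \in matching s)%:R) 1 (l i)).
  by move=> ni; apply: nl; rewrite (bigD1 i) //=; apply: nilpotent_eltM.
split=> [i|i e lie].
  by move=> ni; apply: (nlF i); apply: nilpotent_eltM.
have := nlF i; rewrite lie /=; case: (_ \in _) => //.
by rewrite mulr0 => /(_ (nilpotent_elt0 R)).
Qed.

Lemma perm_size_gt0 : (0 < m)%N.
Proof.
have := projection_eval idfun (fun=> 0 : R).
rewrite big1 => [|s sP]; last first.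
  have [e ee _] := insub_matching_perm (Ordinal n_gt0) sP.
  by rewrite (bigD1 (Ordinal n_gt0)) //= ee mul0r.
have [m0|//] := posnP m.
have no_ord (i : 'I_m) : False by have := leq_trans (ltn_ord i) (eq_leq m0).
rewrite (_ : \sum_s _ = (\sum_(s : 'S_m) \sum_(l : {ffun 'I_m -> Lab}) 1)%N%:R); last first.
  rewrite natr_sum; apply: eq_bigr => s _; rewrite natr_sum; apply: eq_bigr => l _.
  by rewrite big1 // => i; case: (no_ord i).
rewrite (bigD1 1%g) //= (bigD1 [ffun=> None]) //= -addnA add1n => /esym/eqP.
by rewrite (negPf (tosr_natr_neq0 leP _)).
Qed.

Lemma fits_cover (t : 'S_m) (l : 'I_m -> Lab) v :
  fits entry_label t l -> (\sum_i covers (l i) v = 1)%N.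
Proof.
move=> tl; have := projection_eval (polyC : {rmorphism R -> {poly R}})
  (fun e => 'X^(v \in edge_set e)).
set d := (\sum_i _)%N.
have -> : \sum_(s : 'S_(n.*2) | matching_perm s)
    \prod_(i < n) oapp (fun e => 'X^(v \in edge_set e)) 0
       (insub (s (pos_left i), s (pos_right i))) =
    \sum_(s : 'S_(n.*2) | matching_perm s) 'X :> {poly R}.
  apply: eq_bigr => s sP.
  rewrite (bigD1 (pos_index ((s^-1)%g v))) //= big1 => [|i iv].
    have [e -> /= ->] := insub_matching_perm (pos_index ((s^-1)%g v)) sP.
    by rewrite mem_perm_pos_pair eqxx mulr1.
  have [e -> /= ->] := insub_matching_perm i sP.
  by rewrite mem_perm_pos_pair eq_sym (negPf iv).
move=> /(congr1 (fun p : {poly R} => p`_d)).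
rewrite sumr_const coefMn coefX.
have [-> //|d1] := eqVneq d 1%N; rewrite mul0rn => /esym S0.
have le01 : le 0 1.
  apply: (tosr_le01 leP (entry_coef_ge0 _ _)); exact: (tl (Ordinal perm_size_gt0)).
have termE (u : 'S_m) (f : {ffun 'I_m -> Lab}) :
   (\prod_i (polyC (entry_coef (i, u i) (f i)) *
       oapp (fun e => 'X^(v \in edge_set e)) 1 (f i)))`_d =
   (\prod_i entry_coef (i, u i) (f i)) * (d == \sum_i covers (f i) v)%:R%N.
  rewrite big_split /= -rmorph_prod /= coefCM; congr (_ * _).
  rewrite -(coefXn R) -prodrXr (eq_bigr (fun i => 'X^(covers (f i) v))) // => i _.
  by rewrite /covers; case: (f i).
have term0 u f : le 0 ((\prod_i entry_coef (i, u i) (f i)) *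
     (d == \sum_i covers (f i) v)%:R%N).
  apply: (tosr_le0M leP); first by apply: (tosr_le0_prod leP le01) => i; apply: entry_coef_ge0.
  by case: (_ == _); rewrite ?le01 ?(tosr_refl leP).
rewrite coef_sum in S0.
have := tosr_sum_eq0 leP _ S0 t; rewrite coef_sum => S1.
have {}S1 := tosr_sum_eq0 leP _ (S1 _) [ffun i => l i].
move: S1; rewrite termE.
rewrite (eq_bigr (fun i => entry_coef (i, t i) (l i))) => [|i _]; last by rewrite ffunE.
have -> : (\sum_i covers ([ffun i => l i] i) v)%N = d.
  by apply: eq_bigr => i _; rewrite ffunE.
rewrite eqxx mulr1 => S1; exfalso.
have : ~ nilpotent_elt (\prod_i entry_coef (i, t i) (l i)).
  by apply: (not_nilpotent_elt_prod leP) => // i; apply: entry_coef_ge0.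
apply; rewrite S1; first exact: nilpotent_elt0.
all: move=> *; rewrite ?coef_sum.
- by rewrite termE.
by apply: (big_ind (le 0)) => [|x y|f _]; rewrite ?(tosr_refl leP) ?termE //; apply: tosr_le0D.
Qed.

End ProjectionSupport.

Section PathMerging.
Variables (Z : zmodType) (E : eqType) (chi : E -> Z) (A B : pred Z).

Definition endpoint (q : Z * seq E) : Z := q.1 - \sum_(e <- q.2) chi e.

Definition is_path (q : Z * seq E) : Prop :=
  [/\ q.2 != [::], A q.1
    & forall k, (0 < k <= size q.2)%N -> B (q.1 - \sum_(e <- take k q.2) chi e)].

Definition flux (qs : seq (Z * seq E)) (p : Z) : int :=
  \sum_(q <- qs) ((q.1 == p)%:R - (endpoint q == p)%:R).

Lemma is_path_cat a b : is_path a -> is_path b -> endpoint a = b.1 ->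
  is_path (a.1, a.2 ++ b.2).
Proof.
case=> a0 Aa Ba [b0 Ab Bb] ab; split=> //= [|k].
  by case: (a.2) a0.
have [ka|ak] := leqP k (size a.2).
  by rewrite takel_cat // => /andP[k0 _]; apply: Ba; rewrite k0 ka.
rewrite size_cat take_cat [(k < _)%N]ltnNge (ltnW ak) /= => /andP[_ kb].
rewrite big_cat /= opprD addrA -[a.1 - _]/(endpoint a) ab.
by apply: Bb; rewrite subn_gt0 ak leq_subLR.
Qed.

Hypothesis chi_sum_neq0 : forall s, s != [::] -> \sum_(e <- s) chi e != 0.

Lemma merge_paths qs : (forall q, q \in qs -> is_path q) ->
  exists ps, [/\ forall q, q \in ps -> is_path q,
    perm_eq (flatten (map snd ps)) (flatten (map snd qs)),
    flux ps =1 flux qs, (size ps <= size qs)%N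
  & forall a b, a \in ps -> b \in ps -> endpoint a != b.1].
Proof.
elim: {qs}_.+1 {-2}qs (ltnSn (size qs)) => // k IHk qs qsk qsP.
have [/hasP[a aqs /hasP[b bqs /eqP ab]]|nomerge] :=
  boolP (has (fun a => has (fun b => endpoint a == b.1) qs) qs); last first.
  exists qs; split=> // a b aqs bqs; apply: contraNneq nomerge => ab.
  by apply/hasP; exists a => //; apply/hasP; exists b => //; apply/eqP.
have ba : b != a.
  apply: contra_eq_neq ab => ->; have [a0 _ _] := qsP a aqs.
  by rewrite /endpoint -subr_eq0 addrAC subrr add0r oppr_eq0 chi_sum_neq0.
have bqs' : b \in rem a qs.
  by have := bqs; rewrite (perm_mem (perm_to_rem aqs)) inE (negPf ba).
have qsE := perm_to_rem aqs; have := perm_to_rem bqs'.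
rewrite -(perm_cons a) => /(perm_trans qsE) {}qsE.
set rs := rem b _ in qsE; have szqs := perm_size qsE.
have [||ps [psP psl psf pss psn]] := IHk ((a.1, a.2 ++ b.2) :: rs).
- by move: qsk; rewrite szqs /=.
- move=> q; rewrite inE => /predU1P[->|qrs]; last first.
    by apply: qsP; rewrite (perm_mem qsE) !inE qrs !orbT.
  by apply: is_path_cat => //; apply: qsP.
exists ps; split=> // [|p|].
- apply: perm_trans psl _; rewrite perm_sym.
  by apply: perm_trans (perm_flatten (perm_map snd qsE)) _; rewrite /= catA.
- rewrite psf [RHS](perm_big _ qsE) /flux !big_cons /= addrA; congr (_ + _).
  have -> : endpoint (a.1, a.2 ++ b.2) = endpoint b.
    by rewrite /endpoint /= big_cat opprD addrA -[a.1 - _]/(endpoint a) ab.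
  by rewrite ab; ring.
by apply: leq_trans pss _; rewrite szqs /= ltnW.
Qed.

End PathMerging.

Lemma big_pmap_seq (R I J : Type) (idx : R) (op : Monoid.law idx)
    (f : I -> option J) (F : J -> R) (s : seq I) :
  \big[op/idx]_(j <- pmap f s) F j = \big[op/idx]_(i <- s) oapp F idx (f i).
Proof.
elim: s => [|i s IHs] /=; first by rewrite !big_nil.
by rewrite big_cons -IHs; case: (f i) => [j|] /=; rewrite ?big_cons ?Monoid.mul1m.
Qed.

Section Routing.
Variables (n m : nat).
Local Notation V := 'I_(n.*2).
Local Notation Lab := (option (edge n)).
Local Notation point := {ffun V -> int}.

Definition edge_vec (e : edge n) : point := [ffun v => (v \in edge_set e)%:R].

Definition label_vec (o : Lab) : point := oapp edge_vec 0 o.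

Definition support1 (z : point) : {set V} := [set v | z v == 1].

Lemma card_edge_set (e : edge n) : #|edge_set e| = 2%N.
Proof. by rewrite cards2 -val_eqE neq_ltn (valP e). Qed.

Lemma sum_edge_vecE (s : seq (edge n)) v :
  (\sum_(e <- s) edge_vec e) v = (count (fun e => v \in edge_set e) s)%:R.
Proof.
elim: s => [|e s IHs]; first by rewrite big_nil ffunE.
by rewrite big_cons ffunE IHs ffunE /= natrD.
Qed.

Lemma sum_edge_vec_neq0 (s : seq (edge n)) : s != [::] -> \sum_(e <- s) edge_vec e != 0.
Proof.
case: s => // e s _; apply/eqP => /ffunP/(_ (val e).1).
by rewrite sum_edge_vecE /= !inE eqxx [RHS]ffunE => /eqP; rewrite pnatr_eq0.
Qed.

Lemma sum_count_edge_set (s : seq (edge n)) :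
  (\sum_(v : V) count (fun e => v \in edge_set e) s = (size s).*2)%N.
Proof.
elim: s => [|e s IHs] /=; first by rewrite big1.
rewrite big_split /= IHs doubleS -add2n; congr (_ + _)%N.
rewrite -(card_edge_set e) -sum1_card [RHS]big_mkcond.
by apply: eq_bigr => v _; case: ifP.
Qed.

Section DisjointEdges.
Variable s : seq (edge n).
Hypothesis count_le1 : forall v, (count (fun e => v \in edge_set e) s <= 1)%N.

Lemma mem_support1 v :
  (v \in support1 (\sum_(e <- s) edge_vec e)) = has (fun e => v \in edge_set e) s.
Proof.
rewrite inE sum_edge_vecE pnatr_eq1 has_count.
by have := count_le1 v; case: (count _ _) => [|[|]].
Qed.

Lemma card_support1 : #|support1 (\sum_(e <- s) edge_vec e)| = (size s).*2.
Proof.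
rewrite -sum_count_edge_set -sum1_card [LHS]big_mkcond; apply: eq_bigr => v _.
rewrite mem_support1 has_count.
by have := count_le1 v; case: (count _ _) => [|[|]].
Qed.

Lemma splits_support1 (t : 'S_(n.*2)) : {in s, forall e, edge_set e \in matching t} ->
  splits t (support1 (\sum_(e <- s) edge_vec e)).
Proof.
move=> st; apply/forallP => i; rewrite !mem_support1; apply/eqP/eq_in_has => e /st.
case/imsetP=> j _ ->; rewrite !mem_perm_pos_pair !permK; congr (_ == _).
by apply/val_inj; rewrite /= doubleK uphalf_double.
Qed.

End DisjointEdges.

Variables (L : 'I_m -> 'I_m -> Lab -> Prop) (r c : 'I_m -> point).
Hypothesis rcP : forall t l, fits L t l -> forall i, label_vec (l i) = r i + c (t i).
Hypothesis fits1 : forall t l v, fits L t l -> (\sum_i covers (l i) v = 1)%N.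

(* The unlabelled entries move no point, so this is also the number of paths  *)
(* starting at p minus the number ending there, whatever is being routed.     *)
Definition excess (p : point) : int := \sum_i ((r i == p)%:R - (- c i == p)%:R).

Definition sources : seq point := undup [seq p <- codom r | 0 < excess p].
Definition sinks : seq point := undup [seq p <- codom (\- c) | excess p < 0].

Section Route.
Variables (s : 'S_(n.*2)) (t : 'S_m) (l : 'I_m -> Lab).
Hypothesis tl : fits L t l.
Hypothesis ls : forall i e, l i = Some e -> edge_set e \in matching s.

Definition labels : seq (edge n) := pmap l (enum 'I_m).

Definition steps : seq (point * seq (edge n)) :=
  pmap (fun i => omap (fun e => (r i, [:: e])) (l i)) (enum 'I_m).

Lemma count_labels v : count (fun e => v \in edge_set e) labels = 1%N.
Proof.
rewrite -sum1_count big_mkcond big_pmap_seq big_enum -[RHS](fits1 v tl).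
by apply: eq_bigr => i _; rewrite /covers; case: (l i) => //= e; case: ifP.
Qed.

Lemma size_labels : size labels = n.
Proof.
apply: double_inj; rewrite -sum_count_edge_set.
by under eq_bigr do rewrite count_labels; rewrite sum1_card card_ord.
Qed.

Lemma labels_matching : {in labels, forall e, edge_set e \in matching s}.
Proof. by move=> e; rewrite mem_pmap => /mapP[i _ /esym]; apply: ls. Qed.

Lemma flatten_steps : flatten (map snd steps) = labels.
Proof. by rewrite /steps /labels; elim: (enum _) => //= i e <-; case: (l i). Qed.

Lemma size_steps : size steps = n.
Proof.
by rewrite -[RHS]size_labels /steps /labels !size_pmap; apply: eq_count => i; case: (l i).
Qed.

Lemma flux_steps p : flux edge_vec steps p = excess p.
Proof.
rewrite /flux big_pmap_seq big_enum /= /excess sumrB [X in _ - X](reindex_inj (@perm_inj _ t)).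
rewrite -sumrB; apply: eq_bigr => i _; have := rcP tl i.
case: (l i) => [e|] /= E; last first.
  by rewrite -[r i](addrK (c (t i))) -E sub0r subrr.
by rewrite /endpoint /= big_seq1 E opprD addrA subrr add0r.
Qed.

Lemma is_path_steps q : q \in steps ->
  is_path edge_vec (mem (codom r)) (mem (codom (\- c))) q.
Proof.
rewrite mem_pmap => /mapP[i _]; have := rcP tl i.
case: (l i) => //= e E [->]; split=> //=; first exact: codom_f.
move=> [|[|k]] //= _; rewrite big_seq1 E opprD addrA subrr add0r.
exact: (codom_f (\- c)).
Qed.

Lemma routing k : (0 < k)%N ->
  [/\ (size sources <= n)%N, (size sinks <= n)%N
    & (exists i j, splits s (support1 (r i + c j)) /\ #|support1 (r i + c j)| = k.*2)
   \/ (forall v, exists p q, [/\ p \in sources, q \in sinks, v \in support1 (p - q)%R,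
        splits s (support1 (p - q)%R) & (#|support1 (p - q)%R| <= k.*2)%N])].
Proof.
move=> k_gt0.
have [ps [psP psl psf psn psd]] := merge_paths sum_edge_vec_neq0 is_path_steps.
rewrite flatten_steps in psl; rewrite size_steps in psn.
have excessE p : excess p = flux edge_vec ps p by rewrite psf flux_steps.
have path_count q v : q \in ps -> (count (fun e => v \in edge_set e) q.2 <= 1)%N.
  move=> qps; rewrite -(count_labels v) -(seq.permP psl).
  rewrite (seq.permP (perm_flatten (perm_map snd (perm_to_rem qps)))) /= count_cat.
  exact: leq_addr.
have path_edge q e : q \in ps -> e \in q.2 -> e \in labels.
  move=> qps eq; rewrite -(perm_mem psl); apply/flattenP; exists q.2 => //.
  exact: map_f.
have source_path q : q \in ps -> q.1 \in sources.
  move=> qps; rewrite mem_undup mem_filter; have [_ qA _] := psP q qps.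
  apply/andP; split; last exact: qA.
  rewrite excessE /flux (perm_big _ (perm_to_rem qps)) big_cons /= eqxx.
  rewrite (negPf (psd q q qps qps)) subr0 ltr_pwDl // big_seq sumr_ge0 // => a /mem_rem aps.
  by rewrite (negPf (psd a q aps qps)) subr0 ler0n.
have sink_path q : q \in ps -> endpoint edge_vec q \in sinks.
  move=> qps; rewrite mem_undup mem_filter; have [q0 _ /(_ (size q.2))] := psP q qps.
  rewrite lt0n size_eq0 q0 leqnn take_size => /(_ isT) qB.
  apply/andP; split; last exact: qB.
  rewrite excessE /flux (perm_big _ (perm_to_rem qps)) big_cons /= eqxx.
  rewrite eq_sym (negPf (psd q q qps qps)) sub0r ltr_nwDl // ?oppr_lt0 //.
  rewrite big_seq sumr_le0 // => a /mem_rem aps.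
  by rewrite eq_sym (negPf (psd q a qps aps)) sub0r oppr_le0 ler0n.
split.
- rewrite (leq_trans _ psn) // -(size_map fst) uniq_leq_size ?undup_uniq // => p.
  rewrite mem_undup mem_filter excessE => /andP[p0 _].
  apply: contraTT p0 => pn; rewrite -leNgt /flux big_seq sumr_le0 // => q qps.
  suff /negPf -> : q.1 != p by rewrite sub0r oppr_le0 ler0n.
  by apply: contraNneq pn => <-; apply: map_f.
- rewrite (leq_trans _ psn) // -(size_map (endpoint edge_vec)).
  rewrite uniq_leq_size ?undup_uniq // => p.
  rewrite mem_undup mem_filter excessE => /andP[p0 _].
  apply: contraTT p0 => pn; rewrite -leNgt /flux big_seq sumr_ge0 // => q qps.
  suff /negPf -> : endpoint edge_vec q != p by rewrite subr0 ler0n.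
  by apply: contraNneq pn => <-; apply: map_f.
have [/hasP[q qps kq]|/hasPn short] := boolP (has (fun q => (k <= size q.2)%N) ps).
  left; have [_ /codomP[i qi] /(_ k)] := psP q qps; rewrite k_gt0 kq => /(_ isT).
  case/codomP=> j; rewrite /= qi => E; exists i, j.
  have <- : \sum_(e <- take k q.2) edge_vec e = r i + c j.
    by rewrite -(opprK (c j)) -E opprB addrC subrK.
  have k1 v : (count (fun e => v \in edge_set e) (take k q.2) <= 1)%N.
    apply: leq_trans (path_count q v qps).
    by rewrite -{2}(cat_take_drop k q.2) count_cat leq_addr.
  rewrite card_support1 // size_takel //; split=> //.
  by apply: splits_support1 => // e /mem_take eq; apply/labels_matching/(path_edge q).
right=> v; have : has (fun e => v \in edge_set e) labels by rewrite has_count count_labels.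
case/hasP=> e; rewrite -(perm_mem psl) => /flattenP[_ /mapP[q qps ->]] eq ve.
have qE : q.1 - endpoint edge_vec q = \sum_(e <- q.2) edge_vec e.
  by rewrite /endpoint opprB addrC subrK.
exists q.1, (endpoint edge_vec q); rewrite qE source_path ?sink_path //; split=> //.
- by rewrite mem_support1 => [|u]; [apply/hasP; exists e | apply: path_count].
- apply: splits_support1 => [u|f fq]; first exact: path_count.
  exact/labels_matching/(path_edge q).
rewrite card_support1 => [|u]; last exact: path_count.
by rewrite leq_double ltnW // ltnNge short.
Qed.

End Route.
End Routing.

Lemma leq_sum_seq_const (I : eqType) (s : seq I) (F : I -> nat) c :
  {in s, forall i, F i <= c}%N -> (\sum_(i <- s) F i <= size s * c)%N.
Proof.
elim: s => [|i s IHs] Fc; first by rewrite big_nil.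
rewrite big_cons mulSn leq_add ?Fc ?mem_head // IHs // => j js.
by rewrite Fc // inE js orbT.
Qed.

Lemma leq_sum_seq_mem (I : eqType) (s : seq I) (F : I -> nat) i :
  i \in s -> (F i <= \sum_(j <- s) F j)%N.
Proof. by move=> si; rewrite (big_rem i) //= leq_addr. Qed.

Section Counting.
Variables n k : nat.
Hypotheses (n_ge2 : (1 < n)%N) (kn : (16 * k <= n)%N).
Local Notation V := 'I_(n.*2).
Local Notation total := (n.*2)`!.

Definition splitters (S : {set V}) : nat := #|[set s | splits s S]|.

Lemma splitters_bin (S : {set V}) l : #|S| = l.*2 -> (l <= n)%N ->
  (splitters S * 'C(n, l) <= total)%N.
Proof.
move=> Sl ln; have := card_splitting_perm Sl; rewrite -/(splitters S) => H.
have C0 : (0 < 'C(n, l))%N by rewrite bin_gt0.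
rewrite -(leq_pmul2r C0) -mulnA; apply: leq_trans H.
by rewrite leq_mul2l bin_sqr_le orbT.
Qed.

Lemma splitters_short (S : {set V}) : (#|S| <= k.*2)%N ->
  (#|S| * splitters S * n.*2.-1 <= 2 * total)%N.
Proof.
move=> Sk; have [->|/card_gt0P[s]] := posnP (splitters S); first by rewrite muln0.
rewrite inE => /card_split; move: #|[set i | _]| => [|[|l]] Sl.
- by rewrite Sl double0 !mul0n.
- have := card_splitting_perm Sl; rewrite -/(splitters S) Sl bin1.
  have -> : 'C(n.*2, 1.*2) = (n * n.*2.-1)%N by rewrite bin2 -doubleMl doubleK.
  rewrite mulnCA [(_ * n)%N]mulnC leq_pmul2l ?(ltnW n_ge2) // => H.
  by rewrite -mulnA leq_mul2l H.
have ln : (l.+2 <= k)%N by rewrite -leq_double -Sl.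
have lC : ('C(n, 2) <= 'C(n, l.+2))%N by apply: leq_bin2r_half => //; lia.
have H : (splitters S * 'C(n, 2) <= total)%N.
  apply: leq_trans (splitters_bin Sl _); last by lia.
  by rewrite leq_mul2l lC orbT.
have C2 : (2 * 'C(n, 2) = n * n.-1)%N by rewrite -mul_bin_diag bin1.
have SC : (#|S| * n.*2.-1 <= 2 * 'C(n, 2))%N.
  apply: leq_trans (leq_mul Sk (leqnn _)) _; rewrite C2.
  case: (n) n_ge2 kn => [|[|p]] // _ kp; rewrite doubleS /=; nia.
rewrite mulnAC; apply: leq_trans (leq_mul SC (leqnn _)) _.
by rewrite -mulnA leq_mul2l mulnC H.
Qed.

End Counting.

Lemma excess_count_absurd n N X Y : (1 < n)%N -> (0 < N)%N -> (4 * X <= N)%N ->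
    (Y * n.*2.-1 <= n * n * (2 * N))%N ->
  (N * n.*2 <= n.*2 * X + Y)%N -> False.
Proof.
move=> n_ge2 N0 XN YN NXY.
have : (N * n.*2 * n.*2.-1 <= n.*2 * X * n.*2.-1 + n * n * (2 * N))%N.
  by apply: leq_trans (leq_mul NXY (leqnn _)) _; rewrite mulnDl leq_add2l.
case: n n_ge2 {YN NXY} => [|[|p]] // _; rewrite doubleS /=; nia.
Qed.

Lemma projection_size_bound (R : comNzSemiRingType) (le : rel R) n m :
    totally_ordered_semiring le -> (16 <= n)%N ->
    monotone_affine_projection le (perfect_matching_poly R n) (permanent R m) ->
  ('C(n, n %/ 16) <= 4 * (m * m))%N.
Proof.
move=> leP n16 [a0 [a [a0_ge0 a_ge0 projE]]]; set k := (n %/ 16)%N.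
have n_gt0 : (0 < n)%N by lia.
have k_gt0 : (0 < k)%N by rewrite divn_gt0.
have kn : (16 * k <= n)%N by rewrite mulnC leq_divM.
have fits1 t l v (tl : fits (entry_label a0 a) t l) :=
  fits_cover projE leP a0_ge0 a_ge0 n_gt0 (t := t) v tl.
have labelP := matching_label projE leP.
have sum_label (t : 'S_m) (l : 'I_m -> option (edge n)) : fits (entry_label a0 a) t l ->
    \sum_i label_vec (l i) = [ffun _ => 1].
  move=> tl; apply/ffunP => v; rewrite sum_ffunE ffunE.
  transitivity ((\sum_i covers (l i) v)%N%:R : int); last by rewrite (fits1 t).
  rewrite natr_sum; apply: eq_bigr => i _.
  by case: (l i) => [e|]; rewrite /= ffunE.
have [r [c rcP]] := fits_potential sum_label.
rewrite leqNgt; apply/negP => Cm.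
have route s := let: ex_intro t (ex_intro l (conj tl ls)) := labelP s in
  routing rcP fits1 tl ls k_gt0.
pose S (ij : 'I_m * 'I_m) := support1 (r ij.1 + c ij.2).
pose D p q : {set 'I_(n.*2)} := support1 (p - q).
pose X := (\sum_(ij | #|S ij| == k.*2) splitters (S ij))%N.
pose Y := (\sum_(p <- sources r c) \sum_(q <- sinks r c)
   if (#|D p q| <= k.*2)%N then #|D p q| * splitters (D p q) else 0)%N.
have [sz1 sz2 _] := route 1%g.
apply: (@excess_count_absurd n (n.*2)`! X Y); rewrite ?fact_gt0 //; first by lia.
- have XC : (X * 'C(n, k) <= m * m * (n.*2)`!)%N.
    rewrite big_distrl /=; apply: leq_trans (_ : \sum_(ij : 'I_m * 'I_m) (n.*2)`! <= _)%N.
      rewrite big_mkcond; apply: leq_sum => ij _; case: eqP => // Sk.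
      by apply: splitters_bin Sk _; lia.
    by rewrite sum_nat_const card_prod !card_ord.
  have [m0|m_gt0] := posnP m.
    rewrite /X big1 // => -[i j] _.
    by have := leq_trans (ltn_ord i) (eq_leq m0).
  rewrite -(@leq_pmul2l (m * m)) ?muln_gt0 ?m_gt0 //; apply: leq_trans XC.
  by rewrite mulnA [X in (_ <= X)%N]mulnC leq_mul2r [(_ * 4)%N]mulnC (ltnW Cm) orbT.
- rewrite big_distrl /=.
  apply: leq_trans (leq_sum_seq_const (c := (n * (2 * (n.*2)`!))%N) _) _.
    move=> p _; rewrite big_distrl /=.
    apply: leq_trans (leq_sum_seq_const (c := (2 * (n.*2)`!)%N) _) _.
      move=> q _; case: ifP => // Dk; apply: (@splitters_short n k) => //; lia.
    by rewrite leq_mul2r sz2 orbT.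
  by rewrite -mulnA leq_mul2r sz1 orbT.
rewrite -{1}card_Sn -[(#|_| * _)%N]sum_nat_const.
have -> : (n.*2 * X + Y = \sum_(s : 'S_(n.*2))
   (n.*2 * (\sum_(ij | #|S ij| == k.*2) splits s (S ij)) +
    \sum_(p <- sources r c) \sum_(q <- sinks r c)
       if (#|D p q| <= k.*2)%N then #|D p q| * splits s (D p q) else 0))%N.
  have splE A : splitters A = (\sum_(s : 'S_(n.*2)) splits s A)%N.
    by rewrite /splitters -sum1_card big_mkcond; apply: eq_bigr => s _; rewrite inE; case: ifP.
  rewrite big_split /= -big_distrr exchange_big /=; congr (_ * _ + _)%N.
    by apply: eq_bigr => ij _.
  rewrite exchange_big /=; apply: eq_bigr => p _; rewrite exchange_big /=.
  apply: eq_bigr => q _; case: ifP => _; last by rewrite big1.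
  by rewrite splE big_distrr.
apply: leq_sum => s _; have [_ _ [[i [j [sS Sk]]]|short]] := route s.
  apply: leq_trans (leq_addr _ _).
  by rewrite (bigD1 (i, j)) /= ?Sk // sS mulnDr muln1 leq_addr.
apply: leq_trans (leq_addl _ _).
rewrite -[X in (X <= _)%N](card_ord n.*2) -sum1_card.
apply: leq_trans (_ : \sum_(v : 'I_(n.*2)) \sum_(p <- sources r c) \sum_(q <- sinks r c)
   (if (#|D p q| <= k.*2)%N then (v \in D p q) * splits s (D p q) else 0) <= _)%N.
  apply: leq_sum => v _; have [p [q [ps qs vD sD Dk]]] := short v.
  apply: leq_trans (leq_sum_seq_mem _ ps); apply: leq_trans (leq_sum_seq_mem _ qs).
  by rewrite /= Dk vD sD.
rewrite exchange_big /=; apply: leq_sum => p _; rewrite exchange_big /=.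
apply: leq_sum => q _; case: ifP => _; last by rewrite big1.
rewrite -big_distrl /= leq_mul2r -sum1_card [X in (_ <= X)%N]big_mkcond /=.
by rewrite (eq_bigr (fun v => if v \in D p q then 1 else 0)%N) ?leqnn ?orbT // => v _; case: ifP.
Qed.

Lemma exp_size_bound (R : comNzSemiRingType) (le : rel R) n m :
    totally_ordered_semiring le -> (16 <= n)%N ->
    monotone_affine_projection le (perfect_matching_poly R n) (permanent R m) ->
  (2 ^ (n %/ 16) <= 4 * (m * m))%N.
Proof.
move=> leP n16 /(projection_size_bound leP n16); apply: leq_trans.
by apply: leq_exp2_bin; lia.
Qed.

Lemma nat_poly_bound (q : {poly nat}) :
  exists C d, forall n, (0 < n)%N -> (q.[n] <= C * n ^ d)%N.
Proof.
elim/poly_ind: q => [|q b [C [d qC]]]; first by exists 0, 0 => n _; rewrite horner0.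
exists (C + b)%N, d.+1 => n n0; rewrite hornerD hornerMX hornerC mulnDl leq_add //.
  by rewrite expnSr mulnA leq_mul2r qC ?orbT.
by rewrite leq_pmulr // expn_gt0 n0.
Qed.

Lemma exp2_gt_poly C d N :
  exists2 k, (N <= k)%N & (4 * ((C * (16 * k) ^ d) * (C * (16 * k) ^ d)) < 2 ^ k)%N.
Proof.
pose i := (12 * d + 2 * C + 3 + N)%N; exists (2 ^ (i * 2))%N.
  apply: leq_trans (ltnW (ltn_expl _ (ltnSn 1))); rewrite /i; lia.
set e := (C + (4 + i * 2) * d)%N.
have Ce : (C * (16 * 2 ^ (i * 2)) ^ d <= 2 ^ e)%N.
  rewrite /e expnD leq_mul ?(ltnW (ltn_expl C (ltnSn 1))) //.
  by rewrite (expnM 2 (4 + i * 2)) (expnD 2 4).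
apply: leq_ltn_trans (leq_mul (leqnn 4) (leq_mul Ce Ce)) _.
rewrite -(expnD 2 e e) -(expnD 2 2) ltn_exp2l // expnM.
have i2 : (i < 2 ^ i)%N by apply: ltn_expl.
apply: (@leq_trans (i.+1 * i.+1)); last by rewrite mulnn leq_exp2r.
rewrite /e /i; nia.
Qed.

Theorem theorem4p3 (K : realType) :
  (exists eps : K, 0 < eps /\
     forall (R : comNzSemiRingType) (le : rel R),
       totally_ordered_semiring le ->
       exists N : nat, forall n : nat, (N <= n)%N -> forall m : nat,
         monotone_affine_projection le
           (perfect_matching_poly R n) (permanent R m) ->
         2 `^ (eps * n%:R) <= m%:R)
  /\
  (forall (R : comNzSemiRingType) (le : rel R),
     totally_ordered_semiring le ->
     ~ monotone_affine_p_projection le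
         (fun n => perfect_matching_poly R n) (fun m => permanent R m)).
Proof.
split.
  exists 64^-1; split=> [|R le leP]; first by rewrite invr_gt0.
  exists 96%N => n n96 m /(exp_size_bound leP) H.
  have {}H : (2 ^ (n %/ 16) <= 4 * (m * m))%N by apply: H; lia.
  set y := 2 `^ _; have y0 : 0 <= y by apply: powR_ge0.
  have yy : 4 * (y * y) <= (2 ^ (n %/ 16))%N%:R.
    have -> : 4 * (y * y) = 2 `^ (2%:R + (64^-1 * n%:R + 64^-1 * n%:R)).
      have nz2 : (2 : K) != 0 by rewrite pnatr_eq0.
      rewrite !powRD ?nz2 ?implybT //.
      by rewrite powRr1 ?ler0n // -natrM.
    rewrite natrX -powR_mulrn ?ler0n // ler_powR ?ler1n //.
    have n_le : n%:R <= 16 * (n %/ 16)%N%:R + 15 :> K.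
      by rewrite -!(natrM, natrD) ler_nat; lia.
    have n_ge : 96 <= n%:R :> K by rewrite ler_nat.
    lra.
  rewrite leNgt; apply/negP => my.
  have : (4 * (m * m))%N%:R < 4 * (y * y) by rewrite !natrM ltr_pM2l // ltr_pM // ler0n.
  by rewrite ltNge (le_trans yy) // ler_nat.
move=> R le leP [p [[q pq] [N PN]]].
have [C [d qC]] := nat_poly_bound q.
have [k Nk] := exp2_gt_poly C d N.+1.
have k0 : (0 < 16 * k)%N by lia.
rewrite ltnNge => /negP; apply.
have := exp_size_bound leP _ (PN (16 * k)%N _); rewrite mulKn // => H.
apply: leq_trans (H _ _) _; [lia | lia |].
have pC := leq_trans (pq _) (qC _ k0).
by rewrite leq_mul2l /= leq_mul.
Qed.
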